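(* Let $A$ be a Banach algebra and $n\geq 0$. Let $A^{[2n]}$ be dense in $A$ and suppose that $B$ is a Banach $A$-bimodule. Assume that $AB^{**}$ and $B^{**}A$ are subsets of $B$. If $H^1(A,B^* )=0$, then $H^1(A,B^{(2n+1)})=0$.
   Context: $A^{[k]}=\{a_1a_2\cdots a_k : a_1,\dots,a_k\in A\}$ (the set of $k$-fold products); for $n=0$ no density condition is imposed. $B^{(k)}$ is the $k$-th dual of $B$, a Banach $A$-bimodule via $\langle b^{(k)}a,b^{(k-1)}\rangle=\langle b^{(k)},ab^{(k-1)}\rangle$ and $\langle ab^{(k)},b^{(k-1)}\rangle=\langle b^{(k)},b^{(k-1)}a\rangle$. $B$ is identified with its canonical image in $B^{**}$; $AB^{**}=\{ab'':a\in A,b''\in B^{**}\}$ and $B^{**}A=\{b''a: a\in A,b''\in B^{**}\}$. For a Banach $A$-bimodule $E$, $Z^1(A,E)$ is the space of bounded linear maps $D:A\to E$ with $D(xy)=xD(y)+D(x)y$ (derivations), $N^1(A,E)$ is the subspace of inner derivations $\delta_e(a)=ae-ea$ ($e\in E$), and $H^1(A,E)=Z^1(A,E)/N^1(A,E)$. *)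

(* Defs.v *)
From HB Require Import structures.
From mathcomp Require Import all_boot all_order all_algebra.
From mathcomp Require Import complex.
From mathcomp Require Import all_classical all_reals all_analysis.

Set Implicit Arguments.
Unset Strict Implicit.
Unset Printing Implicit Defensive.
Import Order.TTheory GRing.Theory Num.Theory.
Import numFieldNormedType.Exports.
Local Open Scope classical_set_scope.
Local Open Scope ring_scope.

(* Banach spaces are taken over the reals or over the complex numbers: the
   scalar field is a parameter ranging over exactly these two fields. *)
Variant scalar_kind := RealScalars | ComplexScalars.

Definition scalars (R : realType) (c : scalar_kind) : numFieldType :=
  match c with
  | RealScalars => (R : numFieldType)
  | ComplexScalars => (R[i] : numFieldType)
  end.

Lemma scalars_supremums (R : realType) (c : scalar_kind)
    (S : set (scalars R c)) :
  S !=set0 -> (forall x, S x -> 0 <= x) -> (exists M, ubound S M) ->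
  supremums S !=set0.
Proof.
case: c S => /= S S0 Sge [M SM].
  exists (sup S); split; first by apply/sup_upper_bound; split=> //; exists M.
  by move=> x xS; exact: ge_sup.
have SRe x : S x -> x = (complex.Re x)%:C%C.
  by move=> /Sge x0; rewrite RRe_real// ger0_real.
pose T : set R := (@complex.Re R) @` S.
have hT : has_sup T.
  split; first by case: S0 => x Sx; exists (complex.Re x), x.
  exists (complex.Re M) => _ [x Sx <-].
  by have := SM _ Sx; rewrite lecE => /andP[].
exists (sup T)%:C%C; split.
  move=> x Sx; rewrite (SRe _ Sx) lecR.
  by apply: sup_upper_bound => //; exists x.
move=> N SN; have [x Sx] := S0.
have N0 : 0 <= N by apply: le_trans (Sge _ Sx) (SN _ Sx).
have -> : N = (complex.Re N)%:C%C by rewrite RRe_real// ger0_real.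
rewrite lecR; apply: ge_sup; first by case: hT.
move=> _ [y Sy <-]; have := SN _ Sy.
by rewrite lecE => /andP[].
Qed.

Lemma scalars_complete (R : realType) (c : scalar_kind)
    (F : set_system (scalars R c)^o) :
  ProperFilter F -> cauchy F -> cvg F.
Proof.
case: c F => /= F FF; first exact: R_complete.
move=> /cauchyP Fc.
have key (g : R[i] -> R) : (forall x y, (`|g x - g y|%:C)%C <= `|x - y|) ->
    exists l : R, forall e : R, 0 < e -> F [set y | `|l - g y| < e].
  move=> glip.
  have FG : ProperFilter (g @ F) by exact: fmap_proper_filter.
  have /cvg_ex[l gl] : cvg (g @ F).
    apply: R_complete; apply/cauchyP => e e0.
    have [x Fx] := Fc (e%:C)%C ltac:(by rewrite ltcR).
    exists (g x).
    suff : F (g @^-1` ball (g x) e) by [].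
    apply: filterS Fx => y; rewrite -!ball_normE /= => xy.
    by rewrite -ltcR; apply: le_lt_trans xy.
  exists l => e e0.
  by move/cvgrPdist_lt : gl => /(_ e e0).
have [a Fa] := key (@complex.Re R) ltac:(
  by move=> x y; rewrite -raddfB; exact: normc_ge_Re).
have imlip (x y : R[i]) :
    (`|complex.Im x - complex.Im y|%:C)%C <= `|x - y|.
  have -> : complex.Im x - complex.Im y = - complex.Re ((x - y) * 'i%C).
    by rewrite ReiNIm opprK raddfB.
  rewrite normrN; apply: le_trans (normc_ge_Re _) _.
  have i1 : `|'i%C : R[i]| = 1.
    by rewrite normc_def /= expr0n expr1n add0r sqrtr1.
  by rewrite normrM i1 mulr1.
have [b Fb] := key (@complex.Im R) imlip.
apply/cvg_ex; exists (a +i* b)%C; apply/cvgrPdist_lt => e e0.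
have er : e = (complex.Re e)%:C%C by rewrite RRe_real// gtr0_real.
have re0 : 0 < complex.Re e by rewrite -ltcR -er.
have re2 : 0 < complex.Re e / 2 by rewrite divr_gt0.
apply: filterS2 (Fa _ re2) (Fb _ re2) => -[u v] /= au bv.
have -> : ((a +i* b) - (u +i* v))%C = ((a - u)%:C)%C + 'i%C * ((b - v)%:C)%C.
  by rewrite [LHS]complexE.
rewrite er; apply: le_lt_trans (ler_normD _ _) _.
have i1 : `|'i%C : R[i]| = 1.
  by rewrite normc_def /= expr0n expr1n add0r sqrtr1.
have nr (r : R) : `|(r%:C)%C : R[i]| = (`|r|%:C)%C.
  by rewrite normc_def /= expr0n addr0 sqrtr_sqr.
rewrite normrM i1 mul1r !nr -rmorphD /= ltcR.
by rewrite [ltRHS](splitr (complex.Re e)) ltrD.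
Qed.

Section Dual.
Context (R : realType) (c : scalar_kind).
Local Notation K := (scalars R c).

Definition bounded_linear (V W : normedModType K) (f : V -> W) :=
  linear f /\ exists M, forall x, `|f x| <= M * `|x|.

Definition bounded_functional (V : normedModType K) : {pred V -> K^o} :=
  mem [set f : V -> K^o | bounded_linear f].
Arguments bounded_functional : clear implicits.

Record dual_space (V : normedModType K) := Dual {
  dual_fun :> V -> K^o;
  _ : dual_fun \in bounded_functional V }.

Section DualNormedModule.
Context (V : normedModType K).
Implicit Types f g : dual_space V.

HB.instance Definition _ := [isSub for @dual_fun V].
HB.instance Definition _ := [Choice of dual_space V by <:].

Lemma dualP f : bounded_linear f.
Proof. by case: f => f /=; rewrite inE. Qed.

Lemma bounded_functional_submod :
  GRing.subsemimod_closed (bounded_functional V).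
Proof.
split; first split.
- rewrite inE; split; first by move=> a x y; rewrite scaler0 addr0.
  by exists 0 => x; rewrite normr0 mul0r.
- move=> f g; rewrite !inE => -[lf [M fM]] [lg [N gN]]; split.
    move=> a x y.
    have -> : (f + g) (a *: x + y) = f (a *: x + y) + g (a *: x + y) by [].
    by rewrite lf lg scalerDr addrACA.
  exists (M + N) => x; rewrite mulrDl.
  exact: le_trans (ler_normD _ _) (lerD (fM x) (gN x)).
- move=> a f; rewrite !inE => -[lf [M fM]]; split.
    move=> b x y; have -> : (a *: f) (b *: x + y) = a *: f (b *: x + y) by [].
    by rewrite lf scalerDr !scalerA mulrC.
  exists (`|a| * M) => x; have -> : (a *: f) x = a *: f x by [].
  by rewrite normrZ -mulrA ler_wpM2l.
Qed.

HB.instance Definition _ :=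
  GRing.isSubmodClosed.Build K (V -> K^o) (bounded_functional V)
    bounded_functional_submod.
HB.instance Definition _ := [SubChoice_isSubLmodule of dual_space V by <:].

Lemma dual_inj f g : (forall x, f x = g x) -> f = g.
Proof. by move=> fg; apply/val_inj/funext. Qed.

Lemma dualD f g x : (f + g) x = f x + g x.
Proof. by []. Qed.

Lemma dualB f g x : (f - g) x = f x - g x.
Proof. by []. Qed.

Lemma dualZ a f x : (a *: f) x = a *: f x.
Proof. by []. Qed.

Lemma dual_lin f a x y : f (a *: x + y) = a *: f x + f y.
Proof. by case: (dualP f) => lf _; rewrite lf. Qed.

Lemma dual_at0 f : f 0 = 0.
Proof.
by have := dual_lin f (- 1) 0 0; rewrite scaler0 addr0 scaleN1r addNr.
Qed.

Lemma dual_atZ f a x : f (a *: x) = a *: f x.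
Proof. by rewrite -[a *: x]addr0 dual_lin dual_at0 addr0. Qed.

Lemma dual_atD f x y : f (x + y) = f x + f y.
Proof. by rewrite -[x in f (x + y)]scale1r dual_lin scale1r. Qed.

(* Norms take their values in the scalar field K; over the complex numbers this
   is a supremum for the partial order of K, under which comparable elements
   have a real difference. *)
Definition opnorm f : K :=
  supremum 0 [set `|f x| | x in [set x | `|x| <= 1]].

Lemma opnorm_supremums f :
  supremums [set `|f x| | x in [set x | `|x| <= 1]] (opnorm f).
Proof.
have S0 : [set `|f x| | x in [set x : V | `|x| <= 1]] !=set0.
  by exists `|f 0|, 0 => //=; rewrite normr0.
rewrite /opnorm /supremum; case: ifPn => [/eqP S00|_].
  by move: S0; rewrite S00 => -[].
case: xgetP => [y ->//|noS]; have [_ [M fM]] := dualP f.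
suff [y /noS//] : supremums [set `|f x| | x in [set x : V | `|x| <= 1]] !=set0.
apply: scalars_supremums => //; first by move=> _ [x _ <-].
exists `|M| => _ [x /= x1 <-]; apply: le_trans (fM x) _.
have Mx0 : 0 <= M * `|x| by exact: le_trans (fM x).
rewrite -(ger0_norm Mx0) normrM normr_id.
by rewrite ler_piMr.
Qed.

Lemma opnorm_ge0 f : 0 <= opnorm f.
Proof.
have [ub _] := opnorm_supremums f.
by apply: le_trans (ub `|f 0| _) => //; exists 0 => //=; rewrite normr0.
Qed.

Lemma opnorm_bound f x : `|f x| <= opnorm f * `|x|.
Proof.
have [->|x0] := eqVneq x 0; first by rewrite dual_at0 !normr0 mulr0.
have nx0 : 0 < `|x| by rewrite normr_gt0.
have [ub _] := opnorm_supremums f.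
have : `|f (`|x|^-1 *: x)| <= opnorm f.
  apply: ub; exists (`|x|^-1 *: x) => //=.
  by rewrite normrZ normfV normr_id mulVf// gt_eqF.
by rewrite dual_atZ normrZ normfV normr_id ler_pdivrMl// mulrC.
Qed.

Lemma opnorm_min f M :
  0 <= M -> (forall x, `|f x| <= M * `|x|) -> opnorm f <= M.
Proof.
move=> M0 fM; have [_ lub] := opnorm_supremums f.
apply: lub => _ [x /= x1 <-]; apply: le_trans (fM x) _.
by rewrite ler_piMr.
Qed.

Lemma opnormD f g : opnorm (f + g) <= opnorm f + opnorm g.
Proof.
apply: opnorm_min => [|x]; first by rewrite addr_ge0 ?opnorm_ge0.
rewrite dualD mulrDl; apply: le_trans (ler_normD _ _) _.
by rewrite lerD ?opnorm_bound.
Qed.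

Lemma opnormZ a f : opnorm (a *: f) = `|a| * opnorm f.
Proof.
have le b h : opnorm (b *: h) <= `|b| * opnorm h.
  apply: opnorm_min => [|x]; first by rewrite mulr_ge0 ?opnorm_ge0.
  by rewrite dualZ normrZ -mulrA ler_wpM2l ?opnorm_bound.
apply/eqP; rewrite eq_le le /=; have [->|a0] := eqVneq a 0.
  by rewrite normr0 mul0r opnorm_ge0.
have := le a^-1 (a *: f); rewrite scalerA mulVf// scale1r normfV.
by rewrite ler_pdivlMl ?normr_gt0.
Qed.

Lemma opnorm_eq0 f : opnorm f = 0 -> f = 0.
Proof.
move=> f0; apply: dual_inj => x; apply/eqP; rewrite -normr_le0.
by have := opnorm_bound f x; rewrite f0 mul0r.
Qed.

HB.instance Definition _ :=
  @Lmodule_isNormed.Build K (dual_space V) opnorm opnormD opnormZ opnorm_eq0.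

Lemma dual_normE f : `|f| = opnorm f.
Proof. by []. Qed.

Lemma dual_norm_bound f x : `|f x| <= `|f| * `|x|.
Proof. exact: opnorm_bound. Qed.

Lemma dual_norm_min f M :
  0 <= M -> (forall x, `|f x| <= M * `|x|) -> `|f| <= M.
Proof. exact: opnorm_min. Qed.

Lemma dual_complete (F : set_system (dual_space V)) :
  ProperFilter F -> cauchy F -> cvg F.
Proof.
move=> FF /cauchyP Fc.
have cvgx x : cvg ((fun f : dual_space V => f x) @ F).
  apply: scalars_complete; apply/cauchyP => e e0.
  have e'0 : 0 < e / (`|x| + 1) by rewrite divr_gt0// ltr_wpDl.
  have [h Fh] := Fc _ e'0; exists (h x).
  suff : F [set f | ball (h x) e (f x)] by [].
  apply: filterS Fh => f; rewrite -!ball_normE /= => hf.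
  rewrite -dualB; apply: le_lt_trans (dual_norm_bound _ _) _.
  rewrite ltr_pdivlMr ?ltr_wpDl// in hf; apply: le_lt_trans hf.
  by rewrite ler_wpM2l// lerDl.
pose g x : K^o := lim ((fun f : dual_space V => f x) @ F).
have gx x : (fun f : dual_space V => f x) @ F --> g x by exact: cvgx.
have glin : linear g.
  move=> a x y.
  have h : (fun f : dual_space V => f (a *: x + y)) @ F --> a *: g x + g y.
    under eq_fun do rewrite dual_lin.
    by apply: cvgD (gx y); exact: cvgZr (gx x).
  have sep : hausdorff_space K^o by exact: norm_hausdorff.
  exact: (cvg_unique sep (gx (a *: x + y)) h).
have close (e : K) (h : dual_space V) : 0 <= e -> F [set f | `|h - f| <= e] ->
    forall x, `|h x - g x| <= e * `|x|.
  move=> e0 Fh x; apply/ler_addgt0Pr => d d0.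
  have Fd : F [set f | `|g x - f x| <= d] by exact: cvgr_dist_le (gx x) _ d0.
  have [f [/= hf gf]] := filter_ex (filterI Fh Fd).
  rewrite -[h x - g x](subrKA (f x)); apply: le_trans (ler_normD _ _) _.
  rewrite lerD//; last by rewrite distrC.
  rewrite -dualB; apply: le_trans (dual_norm_bound _ _) _.
  by rewrite ler_wpM2r.
have gP : g \in bounded_functional V.
  rewrite inE; split=> //; have [h Fh] := Fc 1 ltr01.
  have hg := close 1 h ler01.
  exists (`|h| + 1) => x; rewrite mulrDl.
  rewrite -[g x](subrK (h x)) addrC; apply: le_trans (ler_normD _ _) _.
  rewrite lerD ?dual_norm_bound// distrC; apply: hg.
  by apply: filterS Fh => f; rewrite -ball_normE /= => /ltW.
apply/cvg_ex; exists (Dual gP); apply/cvgrPdist_le => e e0.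
have e2 : 0 < e / 2 by rewrite divr_gt0.
have [h Fh] := Fc _ e2.
have Fh' : F [set f | `|h - f| <= e / 2].
  by apply: filterS Fh => f; rewrite -ball_normE /= => /ltW.
apply: filterS Fh' => f /= hf; rewrite [leRHS]splitr.
rewrite -(subrKA h) ; apply: le_trans (ler_normD _ _) _.
rewrite lerD//; apply: dual_norm_min => [|x]; first exact: ltW.
rewrite dualB distrC; apply: close; first exact: ltW.
by apply: filterS Fh => k; rewrite -ball_normE /= => /ltW.
Qed.

HB.instance Definition _ :=
  Uniform_isComplete.Build (dual_space V) dual_complete.

End DualNormedModule.

Lemma bidual_embedding_subproof (V : normedModType K) (x : V) :
  (fun f : dual_space V => f x) \in bounded_functional (dual_space V).
Proof.
rewrite inE; split; first by move=> a f g; rewrite dualD dualZ.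
by exists `|x| => f; rewrite mulrC; exact: dual_norm_bound.
Qed.

Definition bidual_embedding (V : normedModType K) (x : V) :
    dual_space (dual_space V) :=
  Dual (bidual_embedding_subproof x).

End Dual.

Arguments bounded_functional {R c} V _.

(* Banach algebras need not be unital, hence are not ringType instances. *)
HB.mixin Record isBanachAlgebra (R : realType) (c : scalar_kind) A
    of CompleteNormedModule (scalars R c) A := {
  bmul : A -> A -> A;
  bmulA : associative bmul;
  bmul_linear_l : forall b, linear (fun a => bmul a b);
  bmul_linear_r : forall a, linear (bmul a);
  bmul_norm : forall a b, `|bmul a b| <= `|a| * `|b| }.

#[short(type="banachAlgType")]
HB.structure Definition BanachAlgebra (R : realType) (c : scalar_kind) :=
  {A of isBanachAlgebra R c A & CompleteNormedModule (scalars R c) A}.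

(* lact a x is a x and ract x a is x a; the actions are jointly bounded, with
   an arbitrary constant. *)
HB.mixin Record isBanachBimodule (R : realType) (c : scalar_kind)
    (A : banachAlgType R c) E of CompleteNormedModule (scalars R c) E := {
  lact : A -> E -> E;
  ract : E -> A -> E;
  lact_linear_l : forall x, linear (fun a => lact a x);
  lact_linear_r : forall a, linear (lact a);
  ract_linear_l : forall a, linear (fun x => ract x a);
  ract_linear_r : forall x, linear (ract x);
  lactM : forall a b x, lact (bmul a b) x = lact a (lact b x);
  ractM : forall a b x, ract x (bmul a b) = ract (ract x a) b;
  lractA : forall a b x, lact a (ract x b) = ract (lact a x) b;
  lact_bounded : exists C, forall a x, `|lact a x| <= C * `|a| * `|x|;
  ract_bounded : exists C, forall a x, `|ract x a| <= C * `|a| * `|x| }.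

#[short(type="banachBimodType")]
HB.structure Definition BanachBimodule (R : realType) (c : scalar_kind)
    (A : banachAlgType R c) :=
  {E of isBanachBimodule R c A E & CompleteNormedModule (scalars R c) E}.

Section DualBimodule.
Context (R : realType) (c : scalar_kind) (A : banachAlgType R c).
Context (E : banachBimodType A).
Local Notation K := (scalars R c).
Implicit Types (a b : A) (x : E) (f : dual_space E).

Lemma dual_lact_subproof a f :
  (fun x : E => f (ract x a)) \in bounded_functional E.
Proof.
rewrite inE; split=> [k x y|]; first by rewrite ract_linear_l dual_lin.
have [C EC] := @ract_bounded _ _ _ E.
exists (`|f| * (C * `|a|)) => x; apply: le_trans (dual_norm_bound _ _) _.
by rewrite -mulrA ler_wpM2l.
Qed.

Lemma dual_ract_subproof f a :
  (fun x : E => f (lact a x)) \in bounded_functional E.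
Proof.
rewrite inE; split=> [k x y|]; first by rewrite lact_linear_r dual_lin.
have [C EC] := @lact_bounded _ _ _ E.
exists (`|f| * (C * `|a|)) => x; apply: le_trans (dual_norm_bound _ _) _.
by rewrite -mulrA ler_wpM2l.
Qed.

(* <a f, x> = <f, x a> and <f a, x> = <f, a x> *)
Definition dual_lact a f : dual_space E := Dual (dual_lact_subproof a f).
Definition dual_ract f a : dual_space E := Dual (dual_ract_subproof f a).

Lemma dual_lact_linear_l f : linear (fun a => dual_lact a f).
Proof.
move=> k a b; apply: dual_inj => x.
by rewrite dualD dualZ /= ract_linear_r dual_lin.
Qed.

Lemma dual_lact_linear_r a : linear (dual_lact a).
Proof. by move=> k f g; apply: dual_inj. Qed.

Lemma dual_ract_linear_l a : linear (fun f => dual_ract f a).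
Proof. by move=> k f g; apply: dual_inj. Qed.

Lemma dual_ract_linear_r f : linear (dual_ract f).
Proof.
move=> k a b; apply: dual_inj => x.
by rewrite dualD dualZ /= lact_linear_l dual_lin.
Qed.

Lemma dual_lactM a b f : dual_lact (bmul a b) f = dual_lact a (dual_lact b f).
Proof. by apply: dual_inj => x /=; rewrite ractM. Qed.

Lemma dual_ractM a b f : dual_ract f (bmul a b) = dual_ract (dual_ract f a) b.
Proof. by apply: dual_inj => x /=; rewrite lactM. Qed.

Lemma dual_lractA a b f :
  dual_lact a (dual_ract f b) = dual_ract (dual_lact a f) b.
Proof. by apply: dual_inj => x /=; rewrite lractA. Qed.

Lemma dual_act_bounded (act : A -> dual_space E -> dual_space E)
    (eact : A -> E -> E) :
  (forall a f x, act a f x = f (eact a x)) ->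
  (exists C, forall a x, `|eact a x| <= C * `|a| * `|x|) ->
  exists C, forall a f, `|act a f| <= C * `|a| * `|f|.
Proof.
move=> actE [C EC]; exists `|C| => a f.
apply: dual_norm_min => [|x]; first by rewrite !mulr_ge0.
rewrite actE; apply: le_trans (dual_norm_bound _ _) _.
rewrite [leRHS]mulrAC mulrC ler_wpM2r//.
have Cx := EC a x; have C0 := le_trans (normr_ge0 _) Cx.
by rewrite (le_trans Cx)// -(ger0_norm C0) !normrM !normr_id.
Qed.

Lemma dual_lact_bounded :
  exists C, forall a f, `|dual_lact a f| <= C * `|a| * `|f|.
Proof. exact: dual_act_bounded (@ract_bounded _ _ _ E). Qed.

Lemma dual_ract_bounded :
  exists C, forall a f, `|dual_ract f a| <= C * `|a| * `|f|.
Proof.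
exact: (@dual_act_bounded (fun a f => dual_ract f a)) (@lact_bounded _ _ _ E).
Qed.

HB.instance Definition _ := isBanachBimodule.Build R c A (dual_space E)
  dual_lact_linear_l dual_lact_linear_r dual_ract_linear_l dual_ract_linear_r
  dual_lactM dual_ractM dual_lractA dual_lact_bounded dual_ract_bounded.

End DualBimodule.

Definition iter_dual (R : realType) (c : scalar_kind) (A : banachAlgType R c)
    (E : banachBimodType A) (k : nat) : banachBimodType A :=
  iter k (fun F : banachBimodType A => dual_space F : banachBimodType A) E.

Section Cohomology.
Context (R : realType) (c : scalar_kind) (A : banachAlgType R c).

(* Products a_1 ... a_k with exactly k >= 1 factors; empty for k = 0 *)
Definition fold_products (k : nat) : set A :=
  [set p | exists (a : A) (s : seq A), (size s).+1 = k /\ p = foldl bmul a s].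

Context (E : banachBimodType A).

Definition Z1 : set (A -> E) :=
  [set D | bounded_linear D /\
           forall x y, D (bmul x y) = lact x (D y) + ract (D x) y].

Definition inner_derivation (e : E) : A -> E := fun a => lact a e - ract e a.

Definition N1 : set (A -> E) := range inner_derivation.

Lemma N1_sub_Z1 : N1 `<=` Z1.
Proof.
move=> _ [e _ <-]; split; last first.
  move=> x y; rewrite /inner_derivation lactM ractM.
  have lB u v : lact x (u - v) = lact x u - lact x v.
    by rewrite -scaleN1r addrC lact_linear_r scaleN1r addrC.
  have rB u v : ract (u - v) y = ract u y - ract v y.
    by rewrite -scaleN1r addrC ract_linear_l scaleN1r addrC.
  by rewrite lB rB lractA addrA subrK.
split.
  move=> k x y; rewrite /inner_derivation lact_linear_l ract_linear_r.
  by rewrite scalerBr opprD addrACA.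
have [C lC] := @lact_bounded _ _ _ E; have [C' rC] := @ract_bounded _ _ _ E.
exists (C * `|e| + C' * `|e|) => a; apply: le_trans (ler_normB _ _) _.
by rewrite mulrDl lerD// mulrAC.
Qed.

(* The quotient Z1 / N1 as the set of cosets D + N1 with D in Z1; its zero
   element is the coset N1. *)
Definition H1 : set (set (A -> E)) :=
  [set [set D + d | d in N1] | D in Z1].

Definition H1_zero : Prop := H1 = [set N1].

Lemma H1_zeroP : H1_zero <-> Z1 `<=` N1.
Proof.
have N10 : N1 0.
  exists 0 => //; apply/funext => a; rewrite /inner_derivation.
  have := lact_linear_r a (- 1) (0 : E) 0.
  rewrite scaler0 addr0 scaleN1r addNr => ->.
  have := ract_linear_l a (- 1) (0 : E) 0.
  rewrite scaler0 addr0 scaleN1r addNr => ->.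
  by rewrite subrr.
have N1Z k e1 e2 :
    k *: inner_derivation e1 + inner_derivation e2 =
    inner_derivation (k *: e1 + e2).
  apply/funext => a; rewrite /inner_derivation lact_linear_r ract_linear_l.
  by rewrite opprD addrACA -scalerBr.
split=> [H D ZD|ZN].
  have : H1 [set D + d | d in N1] by exists D.
  by rewrite H => /= <-; exists 0; rewrite ?addr0.
have coset D : Z1 D -> [set D + d | d in N1] = N1.
  move=> /ZN[e _ <-]; apply/seteqP; split=> [_ [_ [e' _ <-] <-]|_ [e' _ <-]].
    by exists (1 *: e + e') => //; rewrite -N1Z scale1r.
  exists (inner_derivation ((- 1) *: e + e')).
    by exists ((- 1) *: e + e').
  by rewrite -N1Z scaleN1r addrA subrr add0r.
apply/seteqP; split=> [_ [D ZD <-]|_ ->]; first exact: coset.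
by exists 0; [exact: N1_sub_Z1|exact/coset/N1_sub_Z1].
Qed.

End Cohomology.

Arguments fold_products {R c} A k _.

(* Main.v *)
Require Import Defs.
From HB Require Import structures.
From mathcomp Require Import all_boot all_order all_algebra.
From mathcomp Require Import all_classical all_reals all_analysis.
Import Order.TTheory GRing.Theory Num.Theory.
Import numFieldNormedType.Exports.
Local Open Scope classical_set_scope.
Local Open Scope ring_scope.

Set Implicit Arguments.
Unset Strict Implicit.
Unset Printing Implicit Defensive.

(** Let E be the 2n-th dual of B. The canonical embedding of B into E is a
    bimodule map, and every functional g on B extends to a functional on E,
    namely to its canonical image in the dual of E; [extension] records these
    two maps.

    Two facts give the theorem. First, a product of n elements of A, acting on
    either side, moves E into B ([iter_bidual_absorbing]). This goes by
    induction on n: one factor is spent on each passage to the bidual, because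
    the remaining factors already carry the bidual of E to elements determined
    by the bidual of B, which one more factor moves into B by the hypothesis
    ([left_absorbing_bidual], [right_absorbing_bidual]).

    Secondly, let D be a derivation of A into the dual of E
    ([inner_of_absorbing]). Restricting the values D a to B yields a derivation
    into the dual of B, which is inner, given by some f; subtracting the inner
    derivation given by the extension of f to E, one may assume that every D a
    vanishes on B. For x and y products of n elements,
      <D(xy), e> = <D y, e x> + <D x, y e> = 0,
    as e x and y e lie in B. Thus D vanishes on the products of 2n elements,
    which are dense, and D = 0 by continuity. For n = 0 there is nothing to
    prove. *)

(** * Bounded linear maps and adjoints *)

Section BoundedLinear.
Context (R : realType) (c : scalar_kind).
Local Notation K := (scalars R c).

Lemma bounded_linear_ge0 (V W : normedModType K) (T : V -> W) :
  bounded_linear T -> exists2 M, 0 <= M & forall x, `|T x| <= M * `|x|.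
Proof.
move=> [_ [M TM]]; exists `|M| => // x; have TMx := TM x.
have Mx0 := le_trans (normr_ge0 _) TMx.
by rewrite (le_trans TMx)// -(ger0_norm Mx0) normrM normr_id.
Qed.

Lemma bounded_linear_comp (U V W : normedModType K) (S : V -> W) (T : U -> V) :
  bounded_linear S -> bounded_linear T -> bounded_linear (S \o T).
Proof.
move=> bS bT; split=> [k x y|]; first by rewrite /= bT.1 bS.1.
have [M M0 SM] := bounded_linear_ge0 bS; have [_ [N TN]] := bT.
exists (M * N) => x; apply: le_trans (SM _) _.
by rewrite -mulrA ler_wpM2l.
Qed.

Lemma bounded_linearB (V W : normedModType K) (S T : V -> W) :
  bounded_linear S -> bounded_linear T -> bounded_linear (S - T).
Proof.
move=> [lS [M SM]] [lT [N TN]]; split.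
  move=> k x y; have fE z : (S - T) z = S z - T z by [].
  by rewrite !fE lS lT scalerBr opprD addrACA.
exists (M + N) => x; rewrite mulrDl.
exact: le_trans (ler_normB _ _) (lerD (SM x) (TN x)).
Qed.

Lemma bounded_linear_eq0_dense (V W : normedModType K) (T : V -> W) (S : set V) :
  bounded_linear T -> dense S -> (forall x, S x -> T x = 0) ->
  forall x, T x = 0.
Proof.
move=> bT dS TS x; have [M M0 TM] := bounded_linear_ge0 bT.
have M1 : 0 < M + 1 by rewrite ltr_wpDl.
apply/eqP; rewrite -normr_le0; apply/ler_addgt0Pr => e e0; rewrite add0r.
have e'0 : 0 < e / (M + 1) by rewrite divr_gt0.
have [||y [xy Sy]] := dS (ball x (e / (M + 1))).
- by exists x; exact: ballxx.
- exact: ball_open.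
have -> : T x = T (x - y).
  have := bT.1 (- 1) y x.
  by rewrite (TS _ Sy) scaler0 add0r scaleN1r addrC => ->.
move: xy; rewrite -ball_normE /= => /ltW xy.
apply: le_trans (TM _) _.
have -> : e = (M + 1) * (e / (M + 1)) by rewrite mulrC divfK// gt_eqF.
by apply: ler_pM => //; rewrite lerDl.
Qed.

Lemma adjoint_subproof (V W : normedModType K) (T : V -> W)
  (bT : bounded_linear T) (f : dual_space W) :
  (f \o T : V -> K^o) \in bounded_functional V.
Proof.
rewrite inE; apply: bounded_linear_comp => //; exact: dualP.
Qed.

Definition adjoint (V W : normedModType K) (T : V -> W)
    (bT : bounded_linear T) (f : dual_space W) : dual_space V :=
  Dual (adjoint_subproof bT f).

Lemma adjoint_bounded_linear (V W : normedModType K) (T : V -> W)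
    (bT : bounded_linear T) : bounded_linear (adjoint bT).
Proof.
split; first by move=> k f g; apply: dual_inj.
have [M M0 TM] := bounded_linear_ge0 bT; exists M => f.
apply: dual_norm_min => [|x]; first by rewrite mulr_ge0.
apply: le_trans (dual_norm_bound f (T x)) _.
by rewrite [M * _]mulrC -mulrA ler_wpM2l.
Qed.

Lemma bidual_embedding_bounded_linear (V : normedModType K) :
  bounded_linear (@bidual_embedding R c V).
Proof.
split; first by move=> k x y; apply: dual_inj => f /=; rewrite dual_lin.
exists 1 => x; rewrite mul1r; apply: dual_norm_min => // f.
by rewrite [leRHS]mulrC; exact: (dual_norm_bound f x).
Qed.

End BoundedLinear.

(** * Products of several elements and their actions *)

Section Words.
Context (R : realType) (c : scalar_kind) (A : banachAlgType R c).

Lemma bmul_foldl (a b : A) s : bmul a (foldl bmul b s) = foldl bmul a (b :: s).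
Proof.
by elim/last_ind: s => // s d IHs; rewrite -rcons_cons !foldl_rcons bmulA IHs.
Qed.

Lemma fold_products_split m k (p : A) :
  (0 < m)%N -> (0 < k)%N -> fold_products A (m + k) p ->
  exists x y, [/\ fold_products A m x, fold_products A k y & p = bmul x y].
Proof.
case: m k => [|m] [|k]// _ _ [a [s [+ ->]]]; rewrite addSn addnS => -[ss].
have := drop_nth a (_ : (m < size s)%N); rewrite ss ltnS leq_addr => /(_ isT) ds.
exists (foldl bmul a (take m s)), (foldl bmul (nth a s m) (drop m.+1 s)); split.
- exists a, (take m s); split=> //; rewrite size_take ss.
  by rewrite ltnS leq_addr.
- exists (nth a s m), (drop m.+1 s); split=> //; rewrite size_drop ss.
  by rewrite subSS addKn.
- by rewrite bmul_foldl -ds -foldl_cat cat_take_drop.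
Qed.

Lemma lact_foldl (E : banachBimodType A) (a : A) s (e : E) :
  lact (foldl bmul a s) e = foldr lact e (a :: s).
Proof. by elim: s a => // b s IHs a; rewrite -bmul_foldl lactM IHs. Qed.

Lemma ract_foldl (E : banachBimodType A) (a : A) s (e : E) :
  ract e (foldl bmul a s) = foldl ract e (a :: s).
Proof.
elim/last_ind: s => // s b IHs.
by rewrite -rcons_cons !foldl_rcons ractM IHs.
Qed.

Lemma dual_lactE (E : banachBimodType A) a (f : dual_space E) (e : E) :
  lact a f e = f (ract e a).
Proof. by []. Qed.

Lemma dual_ractE (E : banachBimodType A) a (f : dual_space E) (e : E) :
  ract f a e = f (lact a e).
Proof. by []. Qed.

Lemma dual_foldr_lact (E : banachBimodType A) s (f : dual_space E) (e : E) :
  foldr lact f s e = f (foldl ract e s).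
Proof. by elim: s e => //= a s IHs e; rewrite IHs. Qed.

Lemma dual_foldl_ract (E : banachBimodType A) s (f : dual_space E) (e : E) :
  foldl ract f s e = f (foldr lact e s).
Proof. by elim: s f => //= a s IHs f; rewrite IHs. Qed.

End Words.

(** * Differences of derivations *)

Section Derivations.
Context (R : realType) (c : scalar_kind) (A : banachAlgType R c).

Lemma Z1B (E : banachBimodType A) (D D' : A -> E) :
  Z1 D -> Z1 D' -> Z1 (D - D').
Proof.
move=> [bD dD] [bD' dD']; split; first exact: bounded_linearB.
move=> x y; have fE z : (D - D') z = D z - D' z by [].
have lB u v : lact x (u - v) = lact x u - lact x v.
  by rewrite -scaleN1r addrC lact_linear_r scaleN1r addrC.
have rB u v : ract (u - v) y = ract u y - ract v y.
  by rewrite -scaleN1r addrC ract_linear_l scaleN1r addrC.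
by rewrite !fE dD dD' lB rB opprD addrACA.
Qed.

End Derivations.

(** * Extending functionals to even duals *)

Section Extension.
Context (R : realType) (c : scalar_kind) (A : banachAlgType R c).

(** A bimodule map [emb] of B into E together with a linear choice [ext] of
    extensions of functionals along it. For E an even dual of B both maps are the
    canonical embeddings of a space into its iterated biduals. *)
Record extension (B E : banachBimodType A) := Extension {
  emb : B -> E;
  ext : dual_space B -> dual_space E;
  emb_bounded_linear : bounded_linear emb;
  emb_lact : forall a b, emb (lact a b) = lact a (emb b);
  emb_ract : forall a b, emb (ract b a) = ract (emb b) a;
  ext_bounded_linear : bounded_linear ext;
  ext_emb : forall g b, ext g (emb b) = g b }.

Lemma bounded_linear_id (V : normedModType (scalars R c)) :
  bounded_linear (@id V).
Proof. by split=> //; exists 1 => x; rewrite mul1r. Qed.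

Definition extension_refl (B : banachBimodType A) : extension B B :=
  Extension (bounded_linear_id B) (fun _ _ => erefl) (fun _ _ => erefl)
    (bounded_linear_id (dual_space B)) (fun _ _ => erefl).

Definition bidual (E : banachBimodType A) : banachBimodType A :=
  dual_space (dual_space E).

Definition extension_bidual (B E : banachBimodType A) (X : extension B E) :
  extension B (bidual E).
Proof.
apply: (@Extension _ _ (@bidual_embedding _ _ E \o emb X)
                       (@bidual_embedding _ _ (dual_space E) \o ext X)).
- apply: bounded_linear_comp (emb_bounded_linear X).
  exact: bidual_embedding_bounded_linear.
- by move=> a b; apply: dual_inj => f /=; rewrite emb_lact.
- by move=> a b; apply: dual_inj => f /=; rewrite emb_ract.
- apply: bounded_linear_comp (ext_bounded_linear X).
  exact: bidual_embedding_bounded_linear.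
- by move=> g b /=; exact: ext_emb.
Defined.

Section Restriction.
Context (B E : banachBimodType A) (X : extension B E).

Definition restr : dual_space E -> dual_space B :=
  adjoint (emb_bounded_linear X).

Lemma restr_lact a f : restr (lact a f) = lact a (restr f).
Proof. by apply: dual_inj => b /=; rewrite emb_ract. Qed.

Lemma restr_ract a f : restr (ract f a) = ract (restr f) a.
Proof. by apply: dual_inj => b /=; rewrite emb_lact. Qed.

Lemma Z1_restr (D : A -> dual_space E) : Z1 D -> Z1 (restr \o D).
Proof.
move=> [bD dD]; have br := adjoint_bounded_linear (emb_bounded_linear X).
split; first exact: bounded_linear_comp.
move=> x y; rewrite -restr_lact -restr_ract /= dD.
by apply: dual_inj.
Qed.

(** As [emb] is a bimodule map, the inner derivation given by [ext f] evaluates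
    [ext f], on B, only at points of B, where it agrees with f. *)
Lemma restr_inner_vanish (D : A -> dual_space E) f :
  restr \o D = inner_derivation f ->
  forall a b, (D - inner_derivation (ext X f)) a (emb X b) = 0.
Proof.
move=> Df a b; have fE z : (D - inner_derivation (ext X f)) z =
  D z - inner_derivation (ext X f) z by [].
rewrite fE dualB /inner_derivation dualB dual_lactE dual_ractE.
rewrite -emb_lact -emb_ract !ext_emb.
have -> : D a (emb X b) = (restr \o D) a b by [].
by rewrite Df subrr.
Qed.

(** The words of k letters act letter by letter rather than through their
    product, so that the case k = 0, the identity action, makes sense in an
    algebra without unit. *)
Definition left_absorbing k := forall (s : seq A) (e : E),
  size s = k -> exists b, foldr lact e s = emb X b.

Definition right_absorbing k := forall (s : seq A) (e : E),
  size s = k -> exists b, foldl ract e s = emb X b.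

(** A derivation whose values vanish on B kills every product of k + k elements,
    by the Leibniz rule applied to the two halves; the reduction to this case
    uses that the restriction to B of any derivation is inner. *)
Lemma inner_of_absorbing k :
  (0 < k)%N -> dense (fold_products A (k + k)) ->
  left_absorbing k -> right_absorbing k ->
  H1_zero (dual_space B) -> H1_zero (dual_space E).
Proof.
move=> k0 Adense lX rX /H1_zeroP HB; apply/H1_zeroP => D ZD.
have [f _ /esym Df] := HB _ (Z1_restr ZD).
exists (ext X f) => //.
pose G : A -> dual_space E := D - inner_derivation (ext X f).
have ZG : Z1 G.
  by apply: Z1B => //; apply: N1_sub_Z1; exists (ext X f).
have GX a b : G a (emb X b) = 0 by exact: restr_inner_vanish.
suff G0 a : G a = 0.
  by apply/funext => a; apply/esym/eqP; rewrite -subr_eq0; apply/eqP/G0.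
apply: (bounded_linear_eq0_dense ZG.1 Adense) => p.
move=> /(fold_products_split k0 k0)[x [y [[u [s [su ->]]] [v [t [tv ->]]] ->]]].
apply: dual_inj => e; rewrite ZG.2 dualD dual_lactE dual_ractE.
rewrite lact_foldl ract_foldl.
have [b ->] := lX (v :: t) e tv; have [b' ->] := rX (u :: s) e su.
by rewrite !GX addr0.
Qed.

End Restriction.

Section AbsorbingBidual.
Context (B E : banachBimodType A) (X : extension B E).

(** Write w for the word s acting on the left, so that a w is the new word.
    Since w moves E into the copy of B, h w agrees on E with (ext (restr h)) w
    for every functional h on E; hence w phi, for phi in the bidual of E, only
    depends on its pullback psi along ext, which is an element of the bidual
    of B. The extra letter a then acts on psi, and a psi lies in B by
    hypothesis. Explicitly, psi g is the value of phi at the functional sending e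
    to g (w e), with w e regarded as an element of B. *)
Lemma left_absorbing_bidual k :
  [set lact a b'' | a in [set: A] & b'' in [set: bidual B]]
    `<=` range (@bidual_embedding R c B) ->
  left_absorbing X k -> left_absorbing (extension_bidual X) k.+1.
Proof.
move=> AB lX [//|a s] phi [sk]; pose wphi : bidual E := foldr lact phi s.
have wphiE h : wphi h = wphi (ext X (restr X h)).
  rewrite /wphi !dual_foldr_lact; congr (phi _); apply: dual_inj => e.
  rewrite !dual_foldl_ract; have [b ->] := lX s e sk.
  by rewrite ext_emb.
pose psi : bidual B := adjoint (ext_bounded_linear X) wphi.
have [b _ bE] : range (@bidual_embedding R c B) (lact a psi).
  by apply: AB; exists a => //; exists psi.
exists b; apply: dual_inj => f.
have -> : foldr lact phi (a :: s) f = wphi (ract f a) by [].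
rewrite wphiE restr_ract.
have -> : wphi (ext X (ract (restr X f) a)) = lact a psi (restr X f) by [].
by rewrite -bE.
Qed.

(** The mirror image of the previous lemma: the new letter is now the last. *)
Lemma right_absorbing_bidual k :
  [set ract b'' a | b'' in [set: bidual B] & a in [set: A]]
    `<=` range (@bidual_embedding R c B) ->
  right_absorbing X k -> right_absorbing (extension_bidual X) k.+1.
Proof.
move=> BA rX; case/lastP => [//|s a] phi; rewrite size_rcons => -[sk].
pose phiw : bidual E := foldl ract phi s.
have phiwE h : phiw h = phiw (ext X (restr X h)).
  rewrite /phiw !dual_foldl_ract; congr (phi _); apply: dual_inj => e.
  rewrite !dual_foldr_lact; have [b ->] := rX s e sk.
  by rewrite ext_emb.
pose psi : bidual B := adjoint (ext_bounded_linear X) phiw.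
have [b _ bE] : range (@bidual_embedding R c B) (ract psi a).
  by apply: BA; exists psi => //; exists a.
exists b; apply: dual_inj => f; rewrite foldl_rcons.
have -> : ract (foldl ract phi s) a f = phiw (lact a f) by [].
rewrite phiwE restr_lact.
have -> : phiw (ext X (lact a (restr X f))) = ract psi a (restr X f) by [].
by rewrite -bE.
Qed.

End AbsorbingBidual.

Lemma iter_bidual_absorbing (B : banachBimodType A) k :
  [set lact a b'' | a in [set: A] & b'' in [set: bidual B]]
    `<=` range (@bidual_embedding R c B) ->
  [set ract b'' a | b'' in [set: bidual B] & a in [set: A]]
    `<=` range (@bidual_embedding R c B) ->
  exists X : extension B (iter k bidual B),
    left_absorbing X k /\ right_absorbing X k.
Proof.
move=> AB BA; elim: k => [|k [X [lX rX]]].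
  by exists (extension_refl B); split=> -[|//] e _; exists e.
exists (extension_bidual X); split.
- exact: left_absorbing_bidual.
- exact: right_absorbing_bidual.
Qed.

Lemma iter_dual_double (B : banachBimodType A) k :
  iter_dual B (2 * k) = iter k bidual B.
Proof. by elim: k => [|k IHk]; rewrite ?muln0// mulnS /= -IHk. Qed.

End Extension.

Theorem mainTheorem3 (R : realType) (c : scalar_kind) (A : banachAlgType R c)
    (n : nat) (B : banachBimodType A)
    (A2n_dense : (0 < n)%N -> dense (fold_products A (2 * n)))
    (AB_sub : [set lact a b'' | a in [set: A] &
                                b'' in [set: dual_space (dual_space B)]]
              `<=` range (@bidual_embedding R c B))
    (BA_sub : [set ract b'' a | b'' in [set: dual_space (dual_space B)] &
                                a in [set: A]]
              `<=` range (@bidual_embedding R c B))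
    (H1B : H1_zero (dual_space B)) :
  H1_zero (iter_dual B (2 * n).+1).
Proof.
have [->//|n0] := posnP n.
have -> : iter_dual B (2 * n).+1 = dual_space (iter_dual B (2 * n)) by [].
have [X [lX rX]] := iter_bidual_absorbing n AB_sub BA_sub.
rewrite iter_dual_double; apply: (inner_of_absorbing n0 _ lX rX H1B).
by rewrite addnn -mul2n; exact: A2n_dense.
Qed.
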